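(* Let $g,f_1,f_2:\mathbb{R}^2\times\mathbb{R}\to\mathbb{R}$ be smooth functions of $(x,y,\alpha)$ and consider the two-dimensional quasilinear differential-algebraic system $$g(x,y,\alpha)\,\dot x=f_1(x,y,\alpha),\qquad \dot y=f_2(x,y,\alpha).$$ Assume that $M=(0,0)$ is a singular equilibrium-fold point at $\alpha=0$, i.e. $g=g_x=f_1=0$ and $f_2\neq0$ at $(0,0,0)$, and that at $(x,y,\alpha)=(0,0,0)$ $$g_y\neq0,\quad g_{xx}\neq0,\quad \det\frac{\partial(f_1,g)}{\partial(x,y)}\neq0,\quad \det\frac{\partial(g,g_x)}{\partial(y,\alpha)}\neq0,\quad \det\frac{\partial(f_1,g,g_x)}{\partial(x,y,\alpha)}\neq0 .$$ Then for small $\alpha\neq0$ the point $M$ splits into a simple fold and a simple singular equilibrium: there are a neighbourhood $U$ of $M$ and $\alpha_0>0$ such that for every $\alpha$ with $0<|\alpha|<\alpha_0$ the system has in $U$ exactly one fold point and exactly one singular equilibrium, these two points are distinct, and both are simple.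
   Context: Subscripts denote partial derivatives. For fixed $\alpha$: A fold point (or fold) is a point $(x,y)$ with $g=g_x=0$. A fold is simple if at this point $f_1\neq0$, $g_y\neq0$ and $g_{xx}\neq0$. A singular equilibrium is a point with $g=f_1=0$. It is simple if at this point $f_2\neq0$, $g_x\neq0$, $\det\frac{\partial(f_1,g)}{\partial(x,y)}\neq0$, and the linearization matrix at this point of the desingularized system $\dot x=f_1$, $\dot y=f_2\,g$, namely $\begin{pmatrix}f_{1x}&f_{1y}\\ g_xf_2&g_yf_2\end{pmatrix}$, has no eigenvalues on the imaginary axis. *)

(* Defs.v *)
From mathcomp Require Import all_boot all_order all_algebra.
From mathcomp Require Import all_classical all_reals all_analysis.
From mathcomp Require Import complex.
Set Implicit Arguments.
Unset Strict Implicit.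
Unset Printing Implicit Defensive.
Import Order.TTheory GRing.Theory Num.Theory.
Import numFieldNormedType.Exports.
Local Open Scope classical_set_scope.
Local Open Scope ring_scope.

(* A point of the domain is ((x, y), alpha) : R * R * R, so that at a fixed
   alpha the point p = (x, y) of the plane is (p, alpha). *)
Section Defs.
Variable R : realType.
Implicit Types (f g : R * R * R -> R) (a : R) (p : R * R).

Definition ex : R * R * R := (1, 0, 0).
Definition ey : R * R * R := (0, 1, 0).
Definition ea : R * R * R := (0, 0, 1).

(* Class C^k: f is continuous and its three first-order partial derivatives
   exist everywhere and are of class C^(k-1). *)
Fixpoint class_C (k : nat) f : Prop :=
  continuous f /\
  if k is k'.+1 then
    forall v, v \in [:: ex; ey; ea] ->
      (forall q, derivable f q v) /\ class_C k' ('D_v f)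
  else True.

Definition smooth f : Prop := forall k, class_C k f.

(* The Jacobian matrix d(F_1, ..., F_m) / d(v_1, ..., v_m) at q. *)
Definition jac m (F : m.-tuple (R * R * R -> R)) (v : m.-tuple (R * R * R))
    (q : R * R * R) : 'M[R]_m :=
  \matrix_(i, j) 'D_(tnth v j) (tnth F i) q.

Definition fold_point g a p : Prop := g (p, a) = 0 /\ 'D_ex g (p, a) = 0.

Definition simple_fold g f1 a p : Prop :=
  [/\ fold_point g a p, f1 (p, a) != 0, 'D_ey g (p, a) != 0
    & 'D_ex ('D_ex g) (p, a) != 0].

Definition singular_equilibrium g f1 a p : Prop :=
  g (p, a) = 0 /\ f1 (p, a) = 0.

(* Linearization at p of the desingularized system x' = f1, y' = f2 g. *)
Definition linearization g f1 f2 a p : 'M[R]_2 :=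
  jac [tuple f1; f2 * g] [tuple ex; ey] (p, a).

Definition no_imaginary_eigenvalue n (A : 'M[R]_n) : Prop :=
  forall z : R[i]%C,
    eigenvalue (map_mx (real_complex R) A) z -> complex.Re z != 0.

Definition simple_singular_equilibrium g f1 f2 a p : Prop :=
  [/\ singular_equilibrium g f1 a p, f2 (p, a) != 0, 'D_ex g (p, a) != 0,
      \det (jac [tuple f1; g] [tuple ex; ey] (p, a)) != 0
    & no_imaginary_eigenvalue (linearization g f1 f2 a p)].

Definition singular_equilibrium_fold g f1 f2 a p : Prop :=
  [/\ fold_point g a p, singular_equilibrium g f1 a p & f2 (p, a) != 0].

Lemma smooth_derivable f (v q : R * R * R) :
  v \in [:: ex; ey; ea] -> smooth f -> derivable f q v.
Proof. by move=> vE /(_ 1%N) [_ /(_ v vE) []]. Qed.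

Lemma linearizationE g f1 f2 a p : smooth g -> smooth f2 -> g (p, a) = 0 ->
  linearization g f1 f2 a p =
  \matrix_(i < 2, j < 2)
    nth 0 (nth [::]
      [:: [:: 'D_ex f1 (p, a); 'D_ey f1 (p, a)];
          [:: 'D_ex g (p, a) * f2 (p, a); 'D_ey g (p, a) * f2 (p, a)]] i) j.
Proof.
move=> sg sf2 g0.
have D (v : R * R * R) : v \in [:: ex; ey; ea] ->
    'D_v (f2 * g) (p, a) = 'D_v g (p, a) * f2 (p, a).
  move=> vE; rewrite deriveM; [|exact: smooth_derivable..].
  by rewrite g0 scale0r addr0 /GRing.scale /= mulrC.
have xE : ex \in [:: ex; ey; ea] by rewrite !inE eqxx.
have yE : ey \in [:: ex; ey; ea] by rewrite !inE eqxx orbT.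
apply/matrixP => -[[|[|//]] ?] [[|[|//]] ?];
  by rewrite !mxE !(tnth_nth ex, tnth_nth f1) //= D.
Qed.

End Defs.
Arguments ex {R}.
Arguments ey {R}.
Arguments ea {R}.

(* Main.v *)
(* The Jacobian of (f1, g, g_x) in (x, y, alpha) is invertible at M, so M is
   locally the only common zero of these three functions; hence f1 does not
   vanish at a fold, nor g_x at a singular equilibrium, as soon as
   alpha <> 0. At fixed alpha the folds are the zeros of (g, g_x) and the
   singular equilibria those of (f1, g), both with an invertible Jacobian in
   (x, y) at M (for the folds it is - g_y g_xx), so Newton's map is a
   contraction and there is exactly one of each near M. The remaining conditions
   are open and hold at M; for the linearization, g_x = 0 at M and a zero trace
   would give the determinant - (g_y f2)^2 < 0, so there are no imaginary
   eigenvalues. *)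
From HB Require Import structures.
Require Import Defs.
From mathcomp Require Import all_boot all_order all_algebra.
From mathcomp Require Import all_classical all_reals all_analysis.
From mathcomp Require Import complex ring lra.
Import Order.TTheory GRing.Theory Num.Theory.
Import numFieldNormedType.Exports.
Local Open Scope classical_set_scope.
Local Open Scope ring_scope.
Set Implicit Arguments.
Unset Strict Implicit.
Unset Printing Implicit Defensive.

(* Matrices are already normed and complete; this joins the two structures into
   [completeNormedModType], which [banach_fixed_point] requires. *)
HB.instance Definition _ (R : realType) (m n : nat) :=
  Complete.copy 'M[R]_(m.+1, n.+1) 'M[R]_(m.+1, n.+1).

(** * Entrywise estimates for the sup norm of matrices *)

Lemma mx_norm_le (R : realType) m n (A : 'M[R]_(m, n)) (r : R) : 0 <= r ->
  (forall i j, `|A i j| <= r) -> `|A| <= r.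
Proof.
move=> r0 Ar; rewrite [leLHS]/Num.Def.normr /= mx_normrE.
by apply/bigmax_leP; split => // -[i j] _ /=.
Qed.

Lemma entry_le_mx_norm (R : realType) m n (A : 'M[R]_(m, n)) i j :
  `|A i j| <= `|A|.
Proof.
rewrite [leRHS]/Num.Def.normr /= mx_normrE.
by apply/bigmax_geP; right; exists (i, j).
Qed.

(** The norm is the largest entry, not an operator norm: an entry of the product is a sum of [n]
    products, whence the factor [n]. *)
Lemma mulmx_norm_le (R : realType) m n p (A : 'M[R]_(m, n)) (B : 'M[R]_(n, p)) :
  `|A *m B| <= n%:R * `|A| * `|B|.
Proof.
apply: mx_norm_le => [|i j]; first by rewrite !mulr_ge0.
rewrite mxE (le_trans (ler_norm_sum _ _ _))//.
rewrite (@le_trans _ _ (\sum_(k < n) `|A| * `|B|))//.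
  by apply: ler_sum => k _; rewrite normrM ler_pM// entry_le_mx_norm.
by rewrite sumr_const card_ord -[leRHS]mulrA mulr_natl.
Qed.

(** * Newton's map of an approximately linear map *)

Section approximately_linear.
Variables (R : realType) (n : nat) (A : 'M[R]_n.+1) (e r : R).
Variable Phi : 'cV[R]_n.+1 -> 'cV[R]_n.+1.
Hypothesis Au : A \in unitmx.
Hypothesis small_e : n.+1%:R * `|invmx A| * e <= 2^-1.
Hypothesis approxPhi : forall p q : 'cV[R]_n.+1, `|p| <= r -> `|q| <= r ->
  `|Phi p - Phi q - A *m (p - q)| <= e * `|p - q|.

(** The two Newton steps differ by [- invmx A] applied to the linearization error, which [approxPhi]
    bounds; [small_e] then gives the factor one half. *)
Lemma newton_contraction (p q : 'cV[R]_n.+1) : `|p| <= r -> `|q| <= r ->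
  `|(p - invmx A *m Phi p) - (q - invmx A *m Phi q)| <= 2^-1 * `|p - q|.
Proof.
move=> pr qr.
have -> : (p - invmx A *m Phi p) - (q - invmx A *m Phi q) =
    - (invmx A *m (Phi p - Phi q - A *m (p - q))).
  rewrite mulmxBr mulmxA mulVmx// mul1mx mulmxBr.
  by rewrite !opprB addrACA [RHS]addrACA [in RHS](addrC (- q)).
rewrite normrN (le_trans (mulmx_norm_le _ _))//.
apply: le_trans (_ : _ <= n.+1%:R * `|invmx A| * (e * `|p - q|)) _.
  by rewrite ler_wpM2l ?mulr_ge0// approxPhi.
by rewrite mulrA ler_wpM2r.
Qed.

(** When the values of [Phi] agree, Newton's map preserves the difference [p - q], which the
    contraction would halve. *)
Lemma approx_linear_inj (p q : 'cV[R]_n.+1) : `|p| <= r -> `|q| <= r ->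
  Phi p = Phi q -> p = q.
Proof.
move=> pr qr Epq; have := newton_contraction pr qr.
rewrite Epq opprB addrA subrK => pq.
by apply/eqP; rewrite -subr_eq0 -normr_le0; move: (`|_|) pq => t; lra.
Qed.

(** Newton's map halves distances and moves the centre 0 by at most [r / 2], so it sends the closed
    ball of radius [r] into itself. At its Banach fixed point the correction [invmx A *m Phi p]
    vanishes. *)
Lemma approx_linear_zero : 0 <= r ->
  n.+1%:R * `|invmx A| * `|Phi 0| <= r / 2 ->
  exists2 p, `|p| <= r & Phi p = 0.
Proof.
move=> r0 Phi0; set U := [set p : 'cV[R]_n.+1 | `|p| <= r].
have fU : {homo (fun p => p - invmx A *m Phi p) : x / U x >-> U x}.
  move=> p pr; rewrite /U/= -(subrK (0 - invmx A *m Phi 0) (p - _)).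
  rewrite (le_trans (ler_normD _ _))// (splitr r) lerD//.
    rewrite (le_trans (newton_contraction _ _))// ?normr0// subr0 mulrC.
    by rewrite ler_wpM2r.
  by rewrite sub0r normrN (le_trans (mulmx_norm_le _ _)).
have [|||p pr pE] := @banach_fixed_point _ _ U (mkfun fU).
- exists (2^-1)%:nng; split => /=; first by lra.
  by move=> [p q] [pr qr]; exact: newton_contraction.
- rewrite (_ : U = Num.Def.normr @^-1` [set x | x <= r])//.
  apply: closed_comp; last exact: closed_le.
  by move=> x _; exact: norm_continuous.
- by exists 0; rewrite /U/= normr0.
exists p => //; move/eqP: pE; rewrite /= eq_sym -subr_eq0 addrAC subrr sub0r.
rewrite oppr_eq0 => /eqP /(congr1 (mulmx A)).
by rewrite mulmxA mulmxV// mul1mx mulmx0.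
Qed.
End approximately_linear.

(** * Directional derivatives and the mean value theorem *)

Section directional.
Variables (R : realType) (V : normedModType R).
Implicit Types (f : V -> R) (v q : V).

Lemma is_derive_line f v q (t : R) : derivable f (q + t *: v) v ->
  is_derive t 1 (fun s : R => f (q + s *: v)) ('D_v f (q + t *: v)).
Proof.
move=> df.
have E : (fun h : R => h^-1 *: (f (q + (h *: 1 + t) *: v) - f (q + t *: v)))
   = (fun h : R => h^-1 *: (f (h *: v + (q + t *: v)) - f (q + t *: v))).
  apply/funext => h; congr (_ *: (f _ - _)).
  by rewrite scalerDl /GRing.scale /= mulr1 addrCA.
by apply: DeriveDef; rewrite /derivable /derive /= E.
Qed.

Lemma MVT_line f v q (t : R) : (forall p, derivable f p v) ->
  exists2 s, `|s| <= `|t| & f (q + t *: v) - f q = t * 'D_v f (q + s *: v).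
Proof.
move=> df; pose h (s : R) := f (q + s *: v).
have dh (s : R) : is_derive s 1 h ('D_v f (q + s *: v)).
  exact: is_derive_line.
have ch a b : {within `[a, b], continuous h}.
  apply/continuous_subspaceT => s.
  by apply: differentiable_continuous; apply/derivable1_diffP.
have h0 : f q = h 0 by rewrite /h scale0r addr0.
rewrite h0 -/(h t); have [t0|t0] := leP 0 t.
  have [s s0t ->] := MVT_segment t0 (fun s _ => dh s) (@ch _ _).
  move: s0t; rewrite in_itv /= => /andP[s0 st].
  by exists s; rewrite ?ger0_norm// subr0 mulrC.
(* For negative [t] the segment runs from [t] to 0, so the increment comes with the opposite
   sign. *)
have [s s0t E] := MVT_segment (ltW t0) (fun s _ => dh s) (@ch _ _).
move: s0t; rewrite in_itv /= => /andP[s0 st].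
exists s; first by rewrite !ler0_norm ?lerN2 // ltW.
by rewrite -opprB E sub0r mulrN opprK mulrC.
Qed.

(* Walking from [q] along the directions of [s] one after the other, each step
   is controlled by the mean value theorem. *)
Lemma steps_approx f (L : V -> R) (e d : R) (s : seq (R * V)) :
  (forall v, v \in unzip2 s ->
     [/\ `|v| <= 1, forall p, derivable f p v &
         forall p, `|p| < d -> `|'D_v f p - L v| <= e]) ->
  forall q, `|q| + \sum_(x <- s) `|x.1| < d ->
  `|f (q + \sum_(x <- s) x.1 *: x.2) - f q - \sum_(x <- s) x.1 * L x.2|
    <= e * \sum_(x <- s) `|x.1|.
Proof.
elim: s => [|[t v] s IH] sP q.
  by move=> _; rewrite !big_nil addr0 subrr subr0 normr0 mulr0.
rewrite !big_cons /= => qd.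
have [v1 df Df] : [/\ `|v| <= 1, forall p, derivable f p v &
         forall p, `|p| < d -> `|'D_v f p - L v| <= e].
  by apply: sP; rewrite inE eqxx.
have tv (u : R) : `|u *: v| <= `|u|.
  by rewrite normrZ ler_piMr.
have s0 : 0 <= \sum_(x <- s) `|x.1| by apply: sumr_ge0.
have [u ut E] := MVT_line q t df.
rewrite addrA -(subrK (f (q + t *: v)) (f (_ + _ + _))).
set S1 := \sum_(x <- s) _ * _.
(* The error splits into that of the remaining walk from [q + t *: v], left to induction, and that
   of the first step, where the mean value theorem leaves a difference of derivatives. *)
have -> : f (q + t *: v + \sum_(x <- s) x.1 *: x.2) - f (q + t *: v) +
     f (q + t *: v) - f q - (t * L v + S1) =
   (f (q + t *: v + \sum_(x <- s) x.1 *: x.2) - f (q + t *: v) - S1) +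
   t * ('D_v f (q + u *: v) - L v).
  by rewrite mulrBr -E; ring.
rewrite (le_trans (ler_normD _ _))// [leRHS]mulrDr [leRHS]addrC lerD//; last first.
  rewrite normrM mulrC ler_wpM2r// Df// (le_lt_trans (ler_normD _ _))//.
  by move: (tv u) => ?; lra.
apply: IH => [w ws|]; first by apply: sP; rewrite inE ws orbT.
by apply: le_lt_trans qd; rewrite addrA lerD2r (le_trans (ler_normD _ _))// lerD2l.
Qed.
End directional.

(** * Smooth functions and the coordinate axes *)

Lemma smooth_derive (R : realType) (f : R * R * R -> R) (v : R * R * R) :
  v \in [:: ex; ey; ea] -> smooth f -> smooth ('D_v f).
Proof. by move=> vE sf k; have [_ /(_ v vE) []] := sf k.+1. Qed.

Lemma smooth_continuous (R : realType) (f : R * R * R -> R) :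
  smooth f -> continuous f.
Proof. by move=> /(_ 0) []. Qed.

Lemma axis_norm (R : realType) (v : R * R * R) :
  v \in [:: ex; ey; ea] -> `|v| <= 1.
Proof.
by rewrite !inE => /or3P[] /eqP->;
  rewrite !prod_normE /= !(normr0, normr1) !ge_max !lexx ler01.
Qed.

(** * Local inversion along a family of coordinate axes *)

Section frame.
Variables (R : realType) (n : nat).
Variables (F : n.+1.-tuple (R * R * R -> R)) (v : n.+1.-tuple (R * R * R)).
Hypothesis smoothF : forall i, smooth (tnth F i).
Hypothesis axis_v : {subset v <= [:: ex; ey; ea]}.

(** One form serves two systems: base [(0, 0, a)] with axes [ex], [ey] is the plane at fixed alpha,
    and base 0 with all three axes is the whole space. *)
Definition frame_map (b : R * R * R) (w : 'cV[R]_n.+1) : 'cV[R]_n.+1 :=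
  \col_i tnth F i (b + \sum_j w j 0 *: tnth v j).

Let N : R := n.+1%:R.
Let N0 : 0 < N. Proof. by rewrite ltr0n. Qed.

Lemma frame_sum_norm (w : 'cV[R]_n.+1) :
  `|\sum_j w j 0 *: tnth v j| <= N * `|w|.
Proof.
rewrite (le_trans (ler_norm_sum _ _ _))//.
rewrite (@le_trans _ _ (\sum_(k < n.+1) `|w|))//.
  apply: ler_sum => k _; rewrite normrZ (le_trans _ (entry_le_mx_norm w k 0))//.
  by rewrite ler_piMr// axis_norm// axis_v// mem_tnth.
by rewrite sumr_const card_ord -mulr_natl.
Qed.

(** The partial derivatives are continuous at 0, so walking along the axes with [steps_approx] makes
    the map nearly linear. The radius [d] is uniform in the base [b], hence in alpha. *)
Lemma frame_map_approx (e : R) : 0 < e -> exists2 d, 0 < d &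
  forall b (p q : 'cV[R]_n.+1), `|b| <= d -> `|p| <= d -> `|q| <= d ->
  `|frame_map b p - frame_map b q - jac F v 0 *m (p - q)| <= e * `|p - q|.
Proof.
move=> e0; have eN : 0 < e / N by rewrite divr_gt0.
have near_ij i j : \forall x \near (0 : R * R * R),
    `|'D_(tnth v j) (tnth F i) x - 'D_(tnth v j) (tnth F i) 0| <= e / N.
  have /smooth_continuous/(_ 0) : smooth ('D_(tnth v j) (tnth F i)).
    by apply: smooth_derive => //; rewrite axis_v// mem_tnth.
  by move/cvgrPdist_le => /(_ _ eN); apply: filterS => x; rewrite distrC.
have /nbhs_norm0P[d0 /= d00 dP] : \forall x \near (0 : R * R * R), forall i j,
    `|'D_(tnth v j) (tnth F i) x - 'D_(tnth v j) (tnth F i) 0| <= e / N.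
  exact: filter_forall _ (fun i => filter_forall _ (near_ij i)).
(* The starting point [Q] has norm at most [(1 + N) * d] and the walk from it has length at most
   [2 * N * d]; the total [(3 * N + 1) * d] stays strictly below [d0]. *)
have M0 : 0 < 3 * N + 2 by rewrite addr_gt0// mulr_gt0.
exists (d0 / (3 * N + 2)); first by rewrite divr_gt0.
set d := d0 / _; have dE : d * (3 * N + 2) = d0 by rewrite /d divfK// gt_eqF.
have d_gt0 : 0 < d by rewrite divr_gt0.
move=> b p q bd pd qd; apply: mx_norm_le => [|i j]; first by rewrite mulr_ge0// ltW.
rewrite {j}ord1 !mxE.
set Q := b + \sum_j q j 0 *: tnth v j.
pose s := [seq ((p - q) j 0, tnth v j) | j <- index_enum 'I_n.+1].
have -> : b + \sum_j p j 0 *: tnth v j = Q + \sum_(x <- s) x.1 *: x.2.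
  rewrite big_map /= -addrA -big_split; congr (_ + _); apply: eq_bigr => k _.
  by rewrite /= !mxE scalerBl addrCA subrr addr0.
have -> : \sum_j jac F v 0 i j * (p - q) j 0 =
    \sum_(x <- s) x.1 * 'D_(x.2) (tnth F i) 0.
  by rewrite big_map; apply: eq_bigr => k _; rewrite [in LHS]mxE mulrC.
have sN : \sum_(x <- s) `|x.1| <= N * `|p - q|.
  rewrite big_map (@le_trans _ _ (\sum_(k < n.+1) `|p - q|))//.
    by apply: ler_sum => k _; rewrite entry_le_mx_norm.
  by rewrite sumr_const card_ord -mulr_natl.
have -> : e * `|p - q| = (e / N) * (N * `|p - q|).
  by rewrite mulrA divfK// gt_eqF.
rewrite (le_trans (@steps_approx _ _ _ (fun u => 'D_u (tnth F i) 0) (e / N) d0 _ _ _ _))//.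
- move=> u; rewrite /unzip2 -map_comp => /mapP[k _ ->] /=.
  have vk : tnth v k \in [:: ex; ey; ea] by rewrite axis_v// mem_tnth.
  split; first exact: axis_norm.
    by move=> x; apply: smooth_derivable.
  by move=> x xd; apply: dP.
- have pq : `|p - q| <= d + d by rewrite (le_trans (ler_normB _ _))// lerD.
  have Qd : `|Q| <= d + N * d.
    rewrite (le_trans (ler_normD _ _))// lerD// (le_trans (frame_sum_norm _))//.
    by rewrite ler_wpM2l// ltW.
  have : N * `|p - q| <= N * (d + d) by rewrite ler_wpM2l// ltW.
  by move: sN Qd; rewrite -dE; lra.
- by rewrite ler_wpM2l// ltW.
Qed.

Hypothesis F0 : forall i, tnth F i 0 = 0.
Hypothesis detJ : \det (jac F v 0) != 0.

(** Injectivity holds for every base in the ball of radius [d]. Existence takes [b] closer to 0,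
    depending on [r], because the value at [w = 0] is [F] at [b], which must be small compared with
    [r]. *)
Lemma frame_map_local_zero : exists2 d, 0 < d &
  (forall b (p q : 'cV[R]_n.+1), `|b| <= d -> `|p| <= d -> `|q| <= d ->
     frame_map b p = frame_map b q -> p = q) /\
  forall r, 0 < r <= d -> \forall b \near (0 : R * R * R),
     exists2 p : 'cV[R]_n.+1, `|p| <= r & frame_map b p = 0.
Proof.
set A := jac F v 0; have Au : A \in unitmx by rewrite unitmxE unitfE.
pose c := N * `|invmx A|; have c0 : 0 <= c by rewrite mulr_ge0// ltW.
(* Adding 1 keeps the denominator positive, and [c / (2 * (c + 1))] is still at most one half. The
   same constant, scaled by [r], bounds [F] at [b] below. *)
pose e := (2 * (c + 1))^-1.
have e0 : 0 < e by rewrite invr_gt0; lra.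
have ce : c * e <= 2^-1.
  by rewrite /e invfM mulrCA mulrA -mulrA ler_piMr// ler_pdivrMr; lra.
have [d d0 dP] := frame_map_approx e0.
exists d => //; split.
  move=> b p q bd pd qd; apply: (@approx_linear_inj _ _ A e d) => // p' q' ? ?.
  exact: dP.
move=> r /andP[r0 rd].
have cont : forall i, \forall b \near (0 : R * R * R),
    `|tnth F i b| <= r / (2 * (c + 1)).
  move=> i; have /cvgrPdist_le := smooth_continuous (smoothF i) (x := 0).
  rewrite F0 => /(_ (r / (2 * (c + 1)))) H.
  have : 0 < r / (2 * (c + 1)) by rewrite divr_gt0//; lra.
  by move/H; apply: filterS => x; rewrite sub0r normrN.
have nbd : \forall b \near (0 : R * R * R), `|b| <= d.
  apply/nbhs_norm0P; exists d => //= x; exact: ltW.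
move/filter_forall: cont => cont.
near=> b.
have bd : `|b| <= d by near: b.
have Fb : forall i, `|tnth F i b| <= r / (2 * (c + 1)) by near: b.
have approx (p q : 'cV[R]_n.+1) : `|p| <= r -> `|q| <= r ->
    `|frame_map b p - frame_map b q - A *m (p - q)| <= e * `|p - q|.
  by move=> pr qr; apply: dP => //; exact: le_trans rd.
have [|p pr pE] := approx_linear_zero Au ce approx (ltW r0); last by exists p.
rewrite -/c; have : `|frame_map b 0| <= r / (2 * (c + 1)).
  apply: mx_norm_le => [|i j]; first by rewrite divr_ge0//; lra.
  by rewrite mxE big1 ?addr0// => k _; rewrite mxE scale0r.
move=> /(ler_wpM2l c0) /le_trans; apply.
by rewrite mulrCA (ler_pM2l r0); exact: ce.
Unshelve. all: by end_near. Qed.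
End frame.

(** * Eigenvalues of real matrices of order two *)

Lemma det_mx22 (K : comNzRingType) (A : 'M[K]_2) :
  \det A = A 0 0 * A 1 1 - A 0 1 * A 1 0.
Proof.
rewrite (expand_det_row _ 0) !big_ord_recl big_ord0 /cofactor !det_mx11 !mxE.
rewrite addr0 expr0 mul1r /= expr1 mulN1r mulrN.
by congr (A _ _ * A _ _ - A _ _ * A _ _); apply/val_inj.
Qed.

(** For an eigenvalue [i y] with [y] real, the imaginary and real parts of the characteristic
    equation read [y * \tr A = 0] and [\det A = y ^ 2]. Both [y = 0] and a zero trace are then
    excluded. *)
Lemma no_imaginary_eigenvalue_mx2 (R : realType) (A : 'M[R]_2) :
  \det A != 0 -> (\tr A != 0) || (\det A < 0) -> no_imaginary_eigenvalue A.
Proof.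
move=> detA trA [x y]; rewrite /eigenvalue kermx_eq0 row_free_unit unitmxE unitfE.
rewrite negbK det_mx22 !mxE /= mulr1n !mulr0n => /eqP E.
apply/negP => /eqP /= x0; move: E; rewrite {x}x0.
rewrite det_mx22 in detA trA; rewrite /mxtrace !big_ord_recl big_ord0 addr0 in trA.
have E1 : lift ord0 ord0 = 1 :> 'I_2 by apply/val_inj.
rewrite E1 -[ord0]/(0 : 'I_2) in trA.
move: (A 0 0) (A 1 1) (A 0 1) (A 1 0) detA trA => a d b c detA trA.
move=> [] E2 E3.
have y_tr : y * (a + d) = 0 by lra.
have y_det : a * d - b * c = y * y by lra.
move/eqP: y_tr; rewrite mulf_eq0 => /orP[/eqP y0|/eqP tr0].
  by move: detA; rewrite y_det y0 mul0r eqxx.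
by move: trA; rewrite tr0 eqxx y_det /= ltNge -expr2 sqr_ge0.
Qed.

(** * Common zeros of two functions in the plane and of three in space *)

Section zeros.
Variable R : realType.
Implicit Types (F G H : R * R * R -> R).

Lemma det_jac2 F G (v w q : R * R * R) :
  \det (jac [tuple F; G] [tuple v; w] q) =
  'D_v F q * 'D_w G q - 'D_w F q * 'D_v G q.
Proof. by rewrite det_mx22 !mxE !(tnth_nth v, tnth_nth F). Qed.

(** Every radius up to [d] is allowed, so that folds and singular equilibria can later be isolated
    in one common ball. *)
Lemma planar_zero_unique F G : smooth F -> smooth G -> F 0 = 0 -> G 0 = 0 ->
  \det (jac [tuple F; G] [tuple ex; ey] 0) != 0 ->
  exists2 d, 0 < d & forall r, 0 < r <= d -> \forall a \near (0 : R),
    exists p : R * R,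
      [set p | `|p| <= r] `&` [set p | F (p, a) = 0 /\ G (p, a) = 0] = [set p].
Proof.
move=> sF sG F0 G0 detJ.
have s2 : forall i, smooth (tnth [tuple F; G] i).
  by case=> -[|[|//]] ?; rewrite (tnth_nth F).
have z2 : forall i, tnth [tuple F; G] i 0 = 0.
  by case=> -[|[|//]] ?; rewrite (tnth_nth F).
have axis2 : {subset [tuple ex; ey] <= [:: ex; ey; @ea R]}.
  by move=> x; rewrite !inE orbA => ->.
have [d d0 [inj zero]] := frame_map_local_zero s2 axis2 z2 detJ.
exists d => // r rd; have /andP[r0 rd'] := rd.
pose vec (p : R * R) : 'cV[R]_2 := \col_i [eta (fun=> p.2) with 0 |-> p.1] i.
have vec_le p : `|p| <= r -> `|vec p| <= r.
  rewrite prod_normE ge_max => /andP[p1 p2]; apply: mx_norm_le => [|i j].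
    exact: ltW.
  by rewrite mxE /=; case: ifP.
have pointE a (x : 'cV[R]_2) :
    (0, 0, a) + \sum_j x j 0 *: tnth [tuple ex; ey] j = ((x 0 0, x 1 0), a).
  rewrite !big_ord_recl big_ord0 addr0 !(tnth_nth ex) /=.
  have -> : lift ord0 ord0 = 1 :> 'I_2 by apply/val_inj.
  by congr (_, _, _); rewrite /= !scaler0 ?add0r ?addr0 // /GRing.scale /= mulr1.
have vecE p a : frame_map [tuple F; G] [tuple ex; ey] (0, 0, a) (vec p) = 0 <->
    F (p, a) = 0 /\ G (p, a) = 0.
  split=> [/colP E|[Fp Gp]].
    by have := (E 0, E 1); rewrite !mxE pointE !mxE !(tnth_nth F) /=
      -surjective_pairing => -[].
  by apply/colP => i; rewrite !mxE pointE !mxE -surjective_pairing (tnth_nth F);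
    case: i => -[|[|//]] ?.
have /nbhs_norm0P[e /= e0 eP] := zero _ rd.
(* The bound [e] gives existence of the zero; the bound [d] keeps the base [(0, 0, a)] where
   injectivity holds. *)
apply/nbhs_norm0P; exists (Num.min e d) => /=; first by rewrite lt_min e0.
move=> a /=; rewrite lt_min => /andP[ae ad].
have an : `|(0, 0, a) : R * R * R| = `|a|.
  by rewrite !prod_normE /= normr0 maxxx max_r.
have [x xr xE] : exists2 x : 'cV[R]_2, `|x| <= r &
   frame_map [tuple F; G] [tuple ex; ey] (0, 0, a) x = 0.
  by apply: eP; rewrite /= an.
have xvec : x = vec (x 0 0, x 1 0).
  apply/colP => -[[|[|//]] i]; rewrite mxE /=; congr (x _ _); exact/val_inj.
exists (x 0 0, x 1 0); apply/seteqP; split => [p [/= pr /vecE pE]|_ ->].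
  have : vec p = x.
    apply: (inj (0, 0, a)); rewrite ?an ?(ltW ad)//.
    - by rewrite (le_trans _ rd')// vec_le.
    - exact: le_trans rd'.
    - by rewrite pE xE.
  by move=> <-; rewrite !mxE /= -surjective_pairing.
split; last by apply/vecE; rewrite -xvec.
by rewrite /= prod_normE ge_max /= !(le_trans (entry_le_mx_norm _ _ _)).
Qed.

(** With base 0 and all three axes, a common zero near 0 has the same image as 0, and injectivity
    identifies them. *)
Lemma space_zero_isolated F G H : smooth F -> smooth G -> smooth H ->
  F 0 = 0 -> G 0 = 0 -> H 0 = 0 ->
  \det (jac [tuple F; G; H] [tuple ex; ey; ea] 0) != 0 ->
  \forall q \near (0 : R * R * R), F q = 0 -> G q = 0 -> H q = 0 -> q = 0.
Proof.
move=> sF sG sH F0 G0 H0 detJ.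
have s3 : forall i, smooth (tnth [tuple F; G; H] i).
  by case=> -[|[|[|//]]] ?; rewrite (tnth_nth F).
have z3 : forall i, tnth [tuple F; G; H] i 0 = 0.
  by case=> -[|[|[|//]]] ?; rewrite (tnth_nth F).
have [d d0 [inj _]] := frame_map_local_zero s3 (fun _ => id) z3 detJ.
apply/nbhs_norm0P; exists d => //= q /ltW qd Fq Gq Hq.
pose x : 'cV[R]_3 := \col_i nth 0 [:: q.1.1; q.1.2; q.2] i.
have pointE : \sum_j x j 0 *: tnth [tuple ex; ey; ea] j = q.
  rewrite !big_ord_recl big_ord0 addr0 !mxE !(tnth_nth ex) /=.
  rewrite [RHS]surjective_pairing [q.1 in RHS]surjective_pairing.
  by congr (_, _, _); rewrite /= !scaler0 ?add0r ?addr0 /GRing.scale /= mulr1.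
have : x = 0.
  apply: (inj 0); rewrite ?normr0 ?(ltW d0)//.
    apply: mx_norm_le => [|i j]; first exact: ltW.
    rewrite mxE; apply: le_trans qd; rewrite !prod_normE !le_max.
    by case: i => -[|[|[|//]]] ? /=; rewrite lexx ?orbT.
  apply/colP => i; rewrite !mxE pointE add0r big1 => [|k _]; last first.
    by rewrite mxE scale0r.
  by rewrite addr0 !(tnth_nth F); case: i => -[|[|[|//]]] ? /=;
    rewrite ?Fq ?Gq ?Hq ?F0 ?G0 ?H0.
by move=> x0; rewrite -pointE x0 big1// => i _; rewrite mxE scale0r.
Qed.
End zeros.

(** * Linearization and splitting of M *)

(** Where [g] vanishes, the product rule leaves [f2] times the gradient of [g] in the second row, so
    [f2] factors out of the determinant. *)
Lemma linearization_det_trace (R : realType) (g f1 f2 : R * R * R -> R) a p :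
  smooth g -> smooth f2 -> g (p, a) = 0 ->
  \det (linearization g f1 f2 a p) =
    f2 (p, a) * \det (jac [tuple f1; g] [tuple ex; ey] (p, a)) /\
  \tr (linearization g f1 f2 a p) =
    'D_ex f1 (p, a) + 'D_ey g (p, a) * f2 (p, a).
Proof.
move=> sg sf2 g0; rewrite linearizationE// det_jac2 det_mx22.
rewrite /mxtrace !big_ord_recl big_ord0 addr0 !mxE /=; split=> //.
move: ('D_ex f1 _) ('D_ey f1 _) ('D_ex g _) ('D_ey g _) (f2 _) => a1 a2 a3 a4 a5.
by ring.
Qed.

Theorem lemma4p4 (R : realType) (g f1 f2 : R * R * R -> R)
    (smooth_g : smooth g) (smooth_f1 : smooth f1) (smooth_f2 : smooth f2)
    (M_sing_eq_fold : singular_equilibrium_fold g f1 f2 0 (0, 0))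
    (gy_neq0 : 'D_ey g (0, 0, 0) != 0)
    (gxx_neq0 : 'D_ex ('D_ex g) (0, 0, 0) != 0)
    (det_f1_g : \det (jac [tuple f1; g] [tuple ex; ey] (0, 0, 0)) != 0)
    (det_g_gx : \det (jac [tuple g; 'D_ex g] [tuple ey; ea] (0, 0, 0)) != 0)
    (det_f1_g_gx :
       \det (jac [tuple f1; g; 'D_ex g] [tuple ex; ey; ea] (0, 0, 0)) != 0) :
  exists (U : set (R * R)) (a0 : R),
    [/\ nbhs ((0, 0) : R * R) U, 0 < a0 &
      forall a : R, 0 < `|a| < a0 ->
        exists F S : R * R,
          [/\ U `&` [set p | fold_point g a p] = [set F],
              U `&` [set p | singular_equilibrium g f1 a p] = [set S],
              F <> S,
              simple_fold g f1 a F &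
              simple_singular_equilibrium g f1 f2 a S]].
Proof.
case: M_sing_eq_fold => -[]; rewrite -[(0, 0, 0)]/(0 : R * R * R).
rewrite -![(0, 0, 0)]/(0 : R * R * R) in gy_neq0 gxx_neq0 det_f1_g det_f1_g_gx.
move=> g0 gx0 [_ f10] f20.
have ex_axis : ex \in [:: ex; ey; @ea R] by rewrite !inE eqxx.
have ey_axis : ey \in [:: ex; ey; @ea R] by rewrite !inE eqxx orbT.
have sgx := smooth_derive ex_axis smooth_g.
have cont (h : R * R * R -> R) : smooth h -> h q @[q --> (0 : R * R * R)] --> h 0.
  by move=> /smooth_continuous; exact.
have [dF dF0 foldP] : exists2 d, 0 < d & forall r, 0 < r <= d ->
    \forall a \near (0 : R), exists p : R * R,
      [set p | `|p| <= r] `&` [set p | fold_point g a p] = [set p].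
  apply: (planar_zero_unique smooth_g sgx g0 gx0).
  by rewrite det_jac2 gx0 mul0r sub0r oppr_eq0 mulf_neq0.
have [dS dS0 singP] : exists2 d, 0 < d & forall r, 0 < r <= d ->
    \forall a \near (0 : R), exists p : R * R,
      [set p | `|p| <= r] `&` [set p | singular_equilibrium g f1 a p] = [set p].
  have [d d0 dP] := planar_zero_unique smooth_f1 smooth_g f10 g0 det_f1_g.
  exists d => // r /dP; apply: filterS => a [p pE]; exists p; rewrite -pE.
  by apply/seteqP; split => q /= [qr []].
(* At points with [g = 0], [f2 * J] and [T] are the determinant and trace of the linearization; as
   functions on the whole space they are continuous at M. *)
pose J q := \det (jac [tuple f1; g] [tuple ex; ey] q).
pose T q := 'D_ex f1 q + 'D_ey g q * f2 q.
have cJ : J q @[q --> (0 : R * R * R)] --> J 0.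
  rewrite /J det_jac2; under eq_fun do rewrite det_jac2.
  by apply: cvgB; apply: cvgM; apply: cont; exact: smooth_derive.
have cT : T q @[q --> (0 : R * R * R)] --> T 0.
  apply: cvgD; first by apply: cont; exact: smooth_derive.
  by apply: cvgM; apply: cont; [exact: smooth_derive|exact: smooth_f2].
have near_JT : \forall q \near (0 : R * R * R), (T q != 0) || (f2 q * J q < 0).
  have [T0|T0] := eqVneq (T 0) 0; last first.
    by apply: filterS (cvgr_neq0 _ cT T0) => q ->.
  have fJ : f2 q * J q @[q --> (0 : R * R * R)] --> f2 0 * J 0
    by apply: cvgM => //; exact: (cont _ smooth_f2).
  have fJ0 : f2 0 * J 0 < 0.
    move: T0; rewrite /T /J det_jac2 gx0.
    move: ('D_ex f1 0) ('D_ey f1 0) ('D_ey g 0) (f2 0) gy_neq0 f20.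
    move=> x t y z y0 z0 xyz.
    (* A zero trace means [f1_x = - g_y f2], and the 0 is [g_x] at M. *)
    have -> : z * (x * y - t * 0) = - (y * z) ^+ 2.
      by rewrite (_ : x = - (y * z)); [ring|apply/eqP; rewrite -addr_eq0; exact/eqP].
    by rewrite oppr_lt0 exprn_even_gt0//= mulf_neq0.
  by apply: filterS (cvgr_lt _ fJ _ fJ0) => q ->; rewrite orbT.
have : \forall q \near (0 : R * R * R),
  [/\ f2 q != 0, 'D_ey g q != 0, 'D_ex ('D_ex g) q != 0, J q != 0 &
      (T q != 0) || (f2 q * J q < 0)] /\
  (f1 q = 0 -> g q = 0 -> 'D_ex g q = 0 -> q = 0).
  near=> q; split; [split|]; near: q => //.
  - exact: cvgr_neq0 _ (cont _ smooth_f2) f20.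
  - exact: cvgr_neq0 _ (cont _ (smooth_derive ey_axis smooth_g)) gy_neq0.
  - exact: cvgr_neq0 _ (cont _ (smooth_derive ex_axis sgx)) gxx_neq0.
  - exact: cvgr_neq0 _ cJ det_f1_g.
  - exact: space_zero_isolated.
move=> /nbhs_norm0P[e /= e0 eP].
(* Half of [e] puts the closed ball strictly inside the ball where the open conditions hold; [dF]
   and [dS] give uniqueness of both points in it. *)
pose r := Num.min (e / 2) (Num.min dF dS).
have r0 : 0 < r by rewrite !lt_min dF0 dS0 divr_gt0.
have re : r < e by rewrite !gt_min ltr_pdivrMr// ltr_pMr// ltr1n.
have rF : 0 < r <= dF by rewrite r0 !ge_min lexx !orbT.
have rS : 0 < r <= dS by rewrite r0 !ge_min lexx !orbT.
have : \forall a \near (0 : R),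
    (exists p : R * R,
      [set p | `|p| <= r] `&` [set p | fold_point g a p] = [set p]) /\
    (exists p : R * R,
      [set p | `|p| <= r] `&` [set p | singular_equilibrium g f1 a p] = [set p]).
  by near=> a; split; near: a; [exact: foldP|exact: singP].
move=> /nbhs_norm0P[a0 /= a00 aP].
(* The norm on the product is a maximum, so [|a| < e] and [|p| <= r < e] place [(p, a)] in the ball
   of radius [e]. *)
exists [set p | `|p| <= r], (Num.min a0 e); split.
- suff : \forall p \near (0 : R * R), `|p| <= r by [].
  by apply/nbhs_norm0P; exists r => //= p /ltW.
- by rewrite lt_min a00.
move=> a /andP[a_gt0]; rewrite lt_min => /andP[aa0 ae].
have [[F FE] [S SE]] := aP _ aa0.
have [Fr [gF gxF]] : ([set p | `|p| <= r] `&` [set p | fold_point g a p]) F.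
  by rewrite FE.
have [Sr [gS f1S]] :
    ([set p | `|p| <= r] `&` [set p | singular_equilibrium g f1 a p]) S.
  by rewrite SE.
have small p : `|p| <= r -> `|(p, a) : R * R * R| < e.
  by move=> pr; rewrite prod_normE gt_max /= ae andbT (le_lt_trans pr).
have [[_ gyF gxxF _ _] isoF] := eP _ (small _ Fr).
have [[f2S _ _ JS JTS] isoS] := eP _ (small _ Sr).
have a_neq0 p : (p, a) <> 0 :> R * R * R.
  by move=> [_ a_eq0]; move: a_gt0; rewrite a_eq0 normr0 ltxx.
have f1F : f1 (F, a) != 0.
  by apply/eqP => f1F; apply: (a_neq0 F); exact: isoF.
have gxS : 'D_ex g (S, a) != 0.
  by apply/eqP => gxS; apply: (a_neq0 S); exact: isoS.
exists F, S; split => //.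
  by move=> FS; move: f1F; rewrite FS f1S eqxx.
split => //.
have [dE tE] := linearization_det_trace f1 smooth_g smooth_f2 gS.
apply: no_imaginary_eigenvalue_mx2; rewrite dE ?tE//.
by rewrite mulf_neq0.
Unshelve. all: by end_near. Qed.
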